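(* (Substitution Principle.) For all formulas $\varphi,\psi,\chi$ and every propositional variable $x$, the formula $(\varphi\equiv\psi)\rightarrow(\chi[x:=\varphi]\equiv\chi[x:=\psi])$ is a theorem of $\mathit{S5BKE}$, where $\varphi\equiv\psi$ abbreviates $\square(\varphi\leftrightarrow\psi)$ and $\chi[x:=\varphi]$ is the result of replacing every occurrence of $x$ in $\chi$ by $\varphi$.
   Context: Language: formulas are built from propositional variables $V=\{x_0,x_1,\dots\}$ with $\neg,\rightarrow$ and unary operators $\square,K,B$; $\wedge,\vee,\leftrightarrow,\top,\bot$ are the usual classical abbreviations. Axioms of $\mathit{S5BKE}$ (all instances of): (i) every formula having the form of a classical propositional tautology; (ii) $K\varphi\rightarrow\varphi$; (iii) $K\varphi\rightarrow B\varphi$; (iv) $\square\varphi\rightarrow\square\square\varphi$; (v) $\neg\square\varphi\rightarrow\square\neg\square\varphi$; (vi) $\square\varphi\rightarrow K\varphi$; (vii) $K(\varphi\rightarrow\psi)\rightarrow(K\varphi\rightarrow K\psi)$; (viii) $B(\varphi\rightarrow\psi)\rightarrow(B\varphi\rightarrow B\psi)$; (ix) $\square(\varphi\rightarrow\psi)\rightarrow(\square\varphi\rightarrow\square\psi)$; (x) $\neg B\bot$. Rules: modus ponens, and axiom necessitation (if $\varphi$ is an axiom, infer $\square\varphi$; applicable only to axioms). A theorem is a formula derivable from the empty set of premises using axioms and these rules. *)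

(* Defs.v *)
From Stdlib Require Import PeanoNat Bool.

(** [Var n] is the propositional variable x_n. *)
Inductive form : Type :=
| Var : nat -> form
| Neg : form -> form
| Imp : form -> form -> form
| Box : form -> form
| Know : form -> form
| Bel : form -> form.

Definition And (p q : form) : form := Neg (Imp p (Neg q)).
Definition Or (p q : form) : form := Imp (Neg p) q.
Definition Iff (p q : form) : form := And (Imp p q) (Imp q p).
Definition Top : form := Imp (Var 0) (Var 0).
Definition Bot : form := Neg Top.

Definition Equiv (p q : form) : form := Box (Iff p q).

Fixpoint subst (chi : form) (x : nat) (phi : form) : form :=
  match chi with
  | Var y => if Nat.eqb x y then phi else Var y
  | Neg p => Neg (subst p x phi)
  | Imp p q => Imp (subst p x phi) (subst q x phi)
  | Box p => Box (subst p x phi)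
  | Know p => Know (subst p x phi)
  | Bel p => Bel (subst p x phi)
  end.

(** Formulas of classical propositional logic, used only to say what it means
    for a modal formula to have the form of a tautology. *)
Inductive pform : Type :=
| PVar : nat -> pform
| PNeg : pform -> pform
| PImp : pform -> pform -> pform.

Fixpoint peval (v : nat -> bool) (t : pform) : bool :=
  match t with
  | PVar n => v n
  | PNeg p => negb (peval v p)
  | PImp p q => implb (peval v p) (peval v q)
  end.

Definition tautology (t : pform) : Prop := forall v : nat -> bool, peval v t = true.

Fixpoint instantiate (s : nat -> form) (t : pform) : form :=
  match t with
  | PVar n => s n
  | PNeg p => Neg (instantiate s p)
  | PImp p q => Imp (instantiate s p) (instantiate s q)
  end.

Definition has_tautology_form (phi : form) : Prop :=
  exists (t : pform) (s : nat -> form), tautology t /\ phi = instantiate s t.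

Inductive S5BKE_axiom : form -> Prop :=
| ax_taut : forall p, has_tautology_form p -> S5BKE_axiom p
| ax_K_T : forall p, S5BKE_axiom (Imp (Know p) p)
| ax_K_B : forall p, S5BKE_axiom (Imp (Know p) (Bel p))
| ax_Box_4 : forall p, S5BKE_axiom (Imp (Box p) (Box (Box p)))
| ax_Box_5 : forall p, S5BKE_axiom (Imp (Neg (Box p)) (Box (Neg (Box p))))
| ax_Box_K : forall p, S5BKE_axiom (Imp (Box p) (Know p))
| ax_K_dist : forall p q,
    S5BKE_axiom (Imp (Know (Imp p q)) (Imp (Know p) (Know q)))
| ax_B_dist : forall p q,
    S5BKE_axiom (Imp (Bel (Imp p q)) (Imp (Bel p) (Bel q)))
| ax_Box_dist : forall p q,
    S5BKE_axiom (Imp (Box (Imp p q)) (Imp (Box p) (Box q)))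
| ax_B_D : S5BKE_axiom (Neg (Bel Bot)).

(** Necessitation applies to axioms only, not to arbitrary derived formulas. *)
Inductive S5BKE_derives (Gamma : form -> Prop) : form -> Prop :=
| der_prem : forall p, Gamma p -> S5BKE_derives Gamma p
| der_ax : forall p, S5BKE_axiom p -> S5BKE_derives Gamma p
| der_nec : forall p, S5BKE_axiom p -> S5BKE_derives Gamma (Box p)
| der_mp : forall p q,
    S5BKE_derives Gamma (Imp p q) -> S5BKE_derives Gamma p ->
    S5BKE_derives Gamma q.

Definition S5BKE_theorem (phi : form) : Prop :=
  S5BKE_derives (fun _ => False) phi.

(* Main.v *)
Require Import Defs.
From Stdlib Require Import PeanoNat List.
Import ListNotations.

(** Although the rule of necessitation only covers axioms, axiom 4 and the
    distribution axiom for [Box] make it admissible for all theorems. Each of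
    [Box], [Know], [Bel] is normal and implied by [Box], so a strict equivalence
    of [p] and [q] yields the material equivalence of [M p] and [M q], and
    boxing this implication, with axiom 4, yields their strict equivalence. The
    substitution principle then follows by induction on the formula. *)

Lemma theorem_mp (p q : form) :
  S5BKE_theorem (Imp p q) -> S5BKE_theorem p -> S5BKE_theorem q.
Proof. exact (der_mp _ p q). Qed.

Lemma theorem_axiom (p : form) : S5BKE_axiom p -> S5BKE_theorem p.
Proof. exact (der_ax _ p). Qed.

Lemma theorem_nec (p : form) : S5BKE_theorem p -> S5BKE_theorem (Box p).
Proof.
  unfold S5BKE_theorem.
  induction 1 as [p [] | p Hp | p Hp | p q _ IHpq _ IHp].
  - now apply der_nec.
  (* A boxed axiom need not be an axiom itself, so its second box comes from axiom 4. *)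
  - eapply der_mp; [apply der_ax, ax_Box_4 | now apply der_nec].
  - eapply der_mp; [eapply der_mp; [apply der_ax, ax_Box_dist | exact IHpq] |].
    exact IHp.
Qed.

(** The default [Top] only makes the assignment total. *)
Definition assign (l : list form) (n : nat) : form := nth n l Top.

Lemma theorem_taut (l : list form) (t : pform) :
  tautology t -> S5BKE_theorem (instantiate (assign l) t).
Proof.
  intros Ht. apply theorem_axiom, ax_taut. now exists t, (assign l).
Qed.

(** Mirrors the encoding of [Iff], so that instantiation yields [Iff] by computation. *)
Definition PIff (p q : pform) : pform :=
  PNeg (PImp (PImp p q) (PNeg (PImp q p))).

(** Truth tables over [PVar 0] to [PVar 3], enough for every schema below; the goal is matched with
    the instance of [t] by conversion. *)
Ltac prove_taut l t :=
  let v := fresh "v" in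
  apply (theorem_taut l t); intro v; cbn;
  destruct (v 0), (v 1), (v 2), (v 3); reflexivity.

Lemma imp_const (p q : form) : S5BKE_theorem q -> S5BKE_theorem (Imp p q).
Proof.
  apply theorem_mp.
  prove_taut [p; q] (PImp (PVar 1) (PImp (PVar 0) (PVar 1))).
Qed.

(** The S combinator as a tautology; with [imp_const], the K combinator, it replaces a deduction
    theorem for reasoning under a fixed antecedent. *)
Lemma imp_mp (p q r : form) :
  S5BKE_theorem (Imp p (Imp q r)) -> S5BKE_theorem (Imp p q) ->
  S5BKE_theorem (Imp p r).
Proof.
  intros H; apply theorem_mp; revert H; apply theorem_mp.
  prove_taut [p; q; r]
    (PImp (PImp (PVar 0) (PImp (PVar 1) (PVar 2)))
       (PImp (PImp (PVar 0) (PVar 1)) (PImp (PVar 0) (PVar 2)))).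
Qed.

Lemma imp_trans (p q r : form) :
  S5BKE_theorem (Imp p q) -> S5BKE_theorem (Imp q r) ->
  S5BKE_theorem (Imp p r).
Proof. eauto using imp_mp, imp_const. Qed.

Lemma imp_iff (e p q : form) :
  S5BKE_theorem (Imp e (Imp p q)) -> S5BKE_theorem (Imp e (Imp q p)) ->
  S5BKE_theorem (Imp e (Iff p q)).
Proof.
  intros Hpq; apply imp_mp; revert Hpq; apply imp_mp, imp_const.
  prove_taut [p; q]
    (PImp (PImp (PVar 0) (PVar 1)) (PImp (PImp (PVar 1) (PVar 0))
       (PIff (PVar 0) (PVar 1)))).
Qed.

Lemma box_mono (p q : form) :
  S5BKE_theorem (Imp p q) -> S5BKE_theorem (Imp (Box p) (Box q)).
Proof.
  intros H. eapply theorem_mp; [apply theorem_axiom, ax_Box_dist |].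
  now apply theorem_nec.
Qed.

Lemma equiv_refl (p : form) : S5BKE_theorem (Equiv p p).
Proof.
  apply theorem_nec. prove_taut [p] (PIff (PVar 0) (PVar 0)).
Qed.

Lemma equiv_neg (p q : form) :
  S5BKE_theorem (Imp (Equiv p q) (Equiv (Neg p) (Neg q))).
Proof.
  apply box_mono.
  prove_taut [p; q]
    (PImp (PIff (PVar 0) (PVar 1)) (PIff (PNeg (PVar 0)) (PNeg (PVar 1)))).
Qed.

Lemma equiv_imp (p p' q q' : form) :
  S5BKE_theorem
    (Imp (Equiv p p') (Imp (Equiv q q') (Equiv (Imp p q) (Imp p' q')))).
Proof.
  (* Monotonicity boxes the curried tautology at its outer implication; distribution then splits the
     box over the inner one. *)
  eapply imp_trans; [apply box_mono | apply theorem_axiom, ax_Box_dist].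
  prove_taut [p; p'; q; q']
    (PImp (PIff (PVar 0) (PVar 1)) (PImp (PIff (PVar 2) (PVar 3))
       (PIff (PImp (PVar 0) (PVar 2)) (PImp (PVar 1) (PVar 3))))).
Qed.

Lemma equiv_box_imp_l (p q : form) :
  S5BKE_theorem (Imp (Equiv p q) (Box (Imp p q))).
Proof.
  apply box_mono.
  prove_taut [p; q]
    (PImp (PIff (PVar 0) (PVar 1)) (PImp (PVar 0) (PVar 1))).
Qed.

Lemma equiv_box_imp_r (p q : form) :
  S5BKE_theorem (Imp (Equiv p q) (Box (Imp q p))).
Proof.
  apply box_mono.
  prove_taut [p; q]
    (PImp (PIff (PVar 0) (PVar 1)) (PImp (PVar 1) (PVar 0))).
Qed.

(** [HM] merges normality of [M] with its being implied by [Box], so one argument serves all three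
    operators. *)
Lemma equiv_modality (M : form -> form)
    (HM : forall p q, S5BKE_theorem (Imp (Box (Imp p q)) (Imp (M p) (M q))))
    (p q : form) :
  S5BKE_theorem (Imp (Equiv p q) (Equiv (M p) (M q))).
Proof.
  eapply imp_trans; [apply theorem_axiom, ax_Box_4 | apply box_mono].
  apply imp_iff.
  - exact (imp_trans _ _ _ (equiv_box_imp_l p q) (HM p q)).
  - exact (imp_trans _ _ _ (equiv_box_imp_r p q) (HM q p)).
Qed.

Lemma box_imp_box (p q : form) :
  S5BKE_theorem (Imp (Box (Imp p q)) (Imp (Box p) (Box q))).
Proof. apply theorem_axiom, ax_Box_dist. Qed.

Lemma box_imp_know (p q : form) :
  S5BKE_theorem (Imp (Box (Imp p q)) (Imp (Know p) (Know q))).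
Proof.
  eapply imp_trans; [apply theorem_axiom, ax_Box_K |].
  apply theorem_axiom, ax_K_dist.
Qed.

Lemma box_imp_bel (p q : form) :
  S5BKE_theorem (Imp (Box (Imp p q)) (Imp (Bel p) (Bel q))).
Proof.
  (* The passage from [Box] to [Bel] goes through [Know]. *)
  eapply imp_trans; [apply theorem_axiom, ax_Box_K |].
  eapply imp_trans; [apply theorem_axiom, ax_K_B |].
  apply theorem_axiom, ax_B_dist.
Qed.

Theorem theorem3p6 (phi psi chi : form) (x : nat) :
  S5BKE_theorem
    (Imp (Equiv phi psi) (Equiv (subst chi x phi) (subst chi x psi))).
Proof.
  induction chi as [y | p IHp | p IHp q IHq | p IHp | p IHp | p IHp]; cbn [subst].
  - destruct (Nat.eqb x y).
    (* Here the conclusion is the antecedent itself, treated as a single atom. *)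
    + prove_taut [Equiv phi psi] (PImp (PVar 0) (PVar 0)).
    + apply imp_const, equiv_refl.
  - exact (imp_trans _ _ _ IHp (equiv_neg _ _)).
  - exact (imp_mp _ _ _ (imp_trans _ _ _ IHp (equiv_imp _ _ _ _)) IHq).
  - exact (imp_trans _ _ _ IHp (equiv_modality Box box_imp_box _ _)).
  - exact (imp_trans _ _ _ IHp (equiv_modality Know box_imp_know _ _)).
  - exact (imp_trans _ _ _ IHp (equiv_modality Bel box_imp_bel _ _)).
Qed.
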